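(* Let $\Gamma$ be a non-degenerate polar space (of finite or infinite polar rank). Then $$\mathrm{prk}_{\mathrm{WO}}(\Gamma)=\mathrm{prk}(\Gamma).$$
   Context: A point-line geometry is a pair $\Gamma=(P,\mathcal{L})$ where $P$ (points) is a non-empty set and $\mathcal{L}$ (lines) is a family of subsets of $P$, each containing at least two points. A subspace is a subset $S\subseteq P$ such that every line meeting $S$ in at least two points is contained in $S$. Two points are collinear if they are equal or lie on a common line. A polar space is a point-line geometry in which, for every point $p$ and every line $\ell$, $p$ is collinear with either exactly one or all points of $\ell$; it is non-degenerate if no point is collinear with all points. A subspace is singular if its points are pairwise collinear. It is well known that the singular subspaces of a non-degenerate polar space (with the lines contained in them) are projective spaces and that each is contained in a maximal singular subspace. For a singular subspace $S$, $\mathrm{rk}(S)$ is its generating rank: the least cardinality of a set $X\subseteq S$ such that $S$ is the smallest subspace containing $X$. The polar rank is $\mathrm{prk}(\Gamma):=\sup\{\mathrm{rk}(S) : S \text{ a singular subspace of }\Gamma\}$ (supremum of cardinals). A chain of singular subspaces is a (non-empty) set $\mathcal{C}$ of singular subspaces totally ordered by inclusion; its length is $\ell(\mathcal{C}):=|\mathcal{C}|-1$, with $|\mathcal{C}|-1=|\mathcal{C}|$ if $|\mathcal{C}|$ is infinite. $\mathfrak{W}_{\mathrm{sing}}(\Gamma)$ is the family of all chains of singular subspaces of $\Gamma$ (the empty subspace allowed) that are well ordered by inclusion, and $\mathrm{prk}_{\mathrm{WO}}(\Gamma):=\sup\{\ell(\mathcal{C}) : \mathcal{C}\in\mathfrak{W}_{\mathrm{sing}}(\Gamma)\}$.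 *)

(* Defs.v *)
From mathcomp Require Import all_boot finmap all_classical.

Set Implicit Arguments.
Unset Strict Implicit.
Unset Printing Implicit Defensive.

Local Open Scope classical_set_scope.
Local Open Scope card_scope.

(* A cardinal is represented by a type, up to equipotence.  Suprema of sets of
   cardinals are thus determined up to #= only. *)
Definition is_card_sup (F : Type -> Prop) (K : Type) : Prop :=
  (forall L : Type, F L -> [set: L] #<= [set: K]) /\
  (forall M : Type, (forall L : Type, F L -> [set: L] #<= [set: M]) ->
     [set: K] #<= [set: M]).

Record pointLineGeometry := PointLineGeometry {
  points : Type;
  lines : set (set points);
  points_nonempty : [set: points] !=set0;
  lines_ge2 : forall l, lines l -> exists x y, [/\ l x, l y & x <> y]
}.

Section PointLineGeometry.
Variable G : pointLineGeometry.
Implicit Types (p q : points G) (l S X : set (points G)).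

Definition is_subspace S : Prop :=
  forall l, lines l ->
    (exists x y, [/\ (l `&` S) x, (l `&` S) y & x <> y]) -> l `<=` S.

Definition collinear p q : Prop := p = q \/ exists l, [/\ lines l, l p & l q].

Definition is_polar_space : Prop :=
  forall p l, lines l ->
    (exists! q, l q /\ collinear p q) \/ (forall q, l q -> collinear p q).

Definition nondegenerate : Prop := ~ exists p, forall q, collinear p q.

Definition is_singular S : Prop :=
  is_subspace S /\ forall p q, S p -> S q -> collinear p q.

Definition generates X S : Prop := X `<=` S /\ smallest is_subspace X = S.

Definition is_generating_rank S (K : Type) : Prop :=
  (exists X, generates X S /\ [set: K] #= X) /\
  (forall X, generates X S -> [set: K] #<= X).

Definition is_prk (K : Type) : Prop :=
  is_card_sup (fun L => exists S, is_singular S /\ is_generating_rank S L) K.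

Definition is_singular_chain (C : set (set (points G))) : Prop :=
  [/\ C !=set0, C `<=` [set S | is_singular S] & total_on C subset].

(* |C| - 1, where |C| - 1 = |C| for an infinite C. *)
Definition chain_length (C : set (set (points G))) : Type :=
  if `[< finite_set C >] then 'I_(#|` fset_set C |.-1) else {S | C S}.

Definition is_wo_singular_chain (C : set (set (points G))) : Prop :=
  is_singular_chain C /\
  forall D, D `<=` C -> D !=set0 -> exists A, D A /\ forall B, D B -> A `<=` B.

Definition is_prk_WO (K : Type) : Prop :=
  is_card_sup
    (fun L => exists C, is_wo_singular_chain C /\ L = chain_length C) K.

End PointLineGeometry.

(* Main.v *)
Require Import Defs.
From mathcomp Require Import all_boot finmap all_classical.
From mathcomp Require Import wochoice.

(* Span is a finitary closure operator with the exchange property on every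
   singular subspace, so every singular subspace has a basis and its generating
   rank is the cardinality of any independent generating set.  Well-ordering a
   basis gives the chain of spans of initial segments, of length at least the
   rank.  Conversely, in a well-ordered chain C choose for each non-maximal A a
   point of the successor of A outside A: these points are independent, so the
   length of C is at most the rank of the union of C.  The two families of
   cardinals therefore have the same upper bounds.

   Exchange is the Veblen-Young property of singular subspaces.  It follows from
   {p, r}^perp^perp = l for distinct points p, r of a line l, which reduces, in
   the non-degenerate polar space p^perp `&` w^perp for w not collinear with p,
   to the implication x^perp `<=` y^perp -> x = y. *)

Set Implicit Arguments.
Unset Strict Implicit.
Unset Printing Implicit Defensive.

Local Open Scope classical_set_scope.
Local Open Scope card_scope.

(** * Cardinals *)

(** The relation need not be functional: choice turns a maximal Steinitz relation, or a map given by
    cases, into an injection. *)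
Lemma card_le_rel T U (A : set T) (B : set U) (R : T -> U -> Prop) :
    (forall x, A x -> exists2 y, B y & R x y) ->
    (forall x x' y, A x -> A x' -> R x y -> R x' y -> x = x') ->
  A #<= B.
Proof.
move=> Rtot Rinj; apply/card_leP/injfunPex.
have Rtot' (a : A) : exists b : B, R (val a) (val b).
  have [y By Rxy] := Rtot _ (set_mem (valP a)).
  by exists (exist _ y (mem_set By)).
have [f fR] := choice Rtot'.
exists f => // a b _ _ fab; apply/val_inj.
apply: (Rinj _ _ (val (f a))) => //; [exact/set_mem/valP | exact/set_mem/valP |].
by rewrite fab.
Qed.

Lemma card_sig T (D : set T) : [set: {x | D x}] #= D.
Proof.
rewrite card_eq_le; apply/andP; split.
  apply: (@card_le_rel _ _ _ _ (fun y x => x = sval y)) => [[x Dx] _|].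
    by exists x.
  by move=> [x Dx] [x' Dx'] y _ _ -> /= E; apply: eq_exist.
apply: (@card_le_rel _ _ _ _ (fun x y => x = sval y)) => [x Dx|x x' y _ _ -> //].
by exists (exist _ x Dx).
Qed.

Lemma well_order_exists (T : Type) : exists lt : T -> T -> Prop,
  [/\ well_founded lt, forall x y z, lt x y -> lt y z -> lt x z &
      forall x y, [\/ lt x y, x = y | lt y x]].
Proof.
have [R woR] := well_ordering_principle {classic T}.
have woC : @wo_chain {classic T} R predT by move=> A _; exact: woR.
have Rtot x y : R x y || R y x by apply: (@wo_chainW {classic T} R _ woC).
have Ranti x y : R x y -> R y x -> x = y.
  move=> xy yx; apply: (@wo_chain_antisymmetric {classic T} R _ woC) => //.
  by rewrite xy.
have min (A : set T) : A !=set0 -> exists2 x, A x & forall y, A y -> R x y.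
  move=> [x Ax]; have [|z [[Az zmin] _]] := woR (fun x => `[< A x >]).
    by exists x; apply/asboolP.
  by exists z => [|y Ay]; [exact/asboolP | apply/zmin/asboolP].
exists (fun x y => R x y /\ x <> y); split.
- move=> x; apply: contrapT => nAcc.
  have [z nz zmin] := min [set x | ~ Acc (fun x y => R x y /\ x <> y) x]
    (ex_intro _ x nAcc).
  apply: nz; constructor => y [yz nyz]; apply: contrapT => /zmin zy.
  exact/nyz/Ranti.
- move=> x y z [xy nxy] [yz nyz]; split; last first.
    by move=> xz; subst z; apply/nxy/Ranti.
  (* Transitivity comes from the least of the three elements: were it [y] or [z], antisymmetry would
     contradict [nxy] or [nyz]. *)
  have [t tA tmin] := min [set x; y; z] (ex_intro _ x (or_introl (or_introl erefl))).
  have tx := tmin x (or_introl (or_introl erefl)).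
  have ty := tmin y (or_introl (or_intror erefl)).
  have tz := tmin z (or_intror erefl).
  case: tA => [[|]|] /= E; subst t => //.
    by case: nxy; apply: Ranti.
  by case: nyz; apply: Ranti.
- move=> x y; have [<-|nxy] := pselect (x = y); first by constructor 2.
  by case/orP: (Rtot x y); [constructor 1 | constructor 3; split=> // /esym].
Qed.

Lemma wf_minimum T (lt : T -> T -> Prop) (A : set T) : well_founded lt ->
  A !=set0 -> exists2 x, A x & forall y, A y -> ~ lt y x.
Proof.
move=> wf [x Ax]; apply: contrapT => nmin.
have : ~ A x; last by [].
elim: x / (wf x) {Ax} => x _ IH Ax; apply: nmin.
by exists x => // y Ay /IH.
Qed.

(* The supremum is the initial segment of a well-order on [T] formed by the [x]
   whose own initial segment is too small for some [L]; well-founded recursion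
   embeds it into every upper bound, so no comparability of cardinals is used. *)
Lemma card_sup_exists (F : Type -> Prop) (T : Type) :
    (forall L, F L -> [set: L] #<= [set: T]) -> exists K, is_card_sup F K.
Proof.
move=> FT; have [lt [wf _ tot]] := well_order_exists T.
pose I x := [set y | lt y x].
pose D := [set x | exists2 L, F L & ~~ ([set: L] #<= I x)].
exists {x | D x}; have := card_sig D; rewrite card_eq_le => /andP[ED DE].
split=> [L FL|M FM].
  apply: card_le_trans DE; have [|] := pselect (D = setT) => [->|nD]; first exact: FT.
  have [|x nDx xmin] := @wf_minimum _ lt (~` D) wf.
    by apply/set0P; apply/eqP => D0; apply: nD; rewrite -[D]setCK D0 setC0.
  have LIx : [set: L] #<= I x by apply: contrapT => /negP nL; apply: nDx; exists L.
  apply: card_le_trans LIx _; apply: subset_card_le => y /= yx.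
  by apply: contrapT => /xmin.
apply: card_le_trans ED _.
(* An empty [M] has no default value for [xget], but it forces every [L] in [F] to be empty, hence
   also [D]. *)
have [m0|M0] := pselect (inhabited M); last first.
  suff -> : D = set0 by exact: card_ge0.
  rewrite -subset0 => x [L FL /negP]; apply.
  apply: card_le_trans (FM _ FL) _.
  by apply: (@card_le_rel _ _ _ _ (fun _ _ => True)) => m; case: M0.
case: m0 => m0.
pose step x (rec : forall z, lt z x -> {classic M}) : {classic M} :=
  xget (m0 : {classic M}) [set y | forall z (h : lt z x), rec z h <> y].
pose f := Fix wf (fun _ => {classic M}) step.
have fE x : f x = step x (fun z _ => f z).
  rewrite /f Fix_eq // => {}x g h gh; rewrite /step; congr (xget _ _).
  by apply/seteqP; split=> y /= H z hz; [rewrite -gh | rewrite gh].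
have fD x z : D x -> lt z x -> f z <> f x.
  move=> [L FL /negP nL] zx; rewrite (fE x) /step.
  case: xgetP => [y _ /(_ z zx) //|none] _; apply: nL.
  apply: card_le_trans (FM _ FL) _.
  apply: (@card_le_rel _ _ _ _ (fun y z => f z = y)) => [y _|y y' z' _ _ <- //].
  apply: contrapT => ny; apply: (none y) => z' hz' E; apply: ny.
  by exists z'.
apply: (@card_le_rel _ _ _ _ (fun x y => f x = y)) => [x _|x x' y Dx Dx' <- E].
  by exists (f x).
by case: (tot x x') => // /fD; [case/(_ Dx') | case/(_ Dx)].
Qed.

(* Shift a sequence of distinct points of [A `\ m] to make room for [m]. *)
Lemma infinite_setD1_card T (A : set T) (m : T) : infinite_set A -> A #<= A `\ m.
Proof.
elim/Ppointed: T => T in A m *; first by rewrite emptyE => /infinite_setN0 [].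
move=> Ainf.
have /infiniteP/pcard_leP[f] : infinite_set (A `\ m).
  exact/infinite_setD/finite_set1.
pose R x y := [\/ x = m /\ y = f 0%N, exists2 n, x <> m & x = f n /\ y = f n.+1 |
  x <> m /\ y = x /\ forall n, x <> f n].
have fI : injective f by move=> i j; apply: 'inj_f; rewrite in_setT.
have fA n : (A `\ m) (f n) by apply: funS.
apply: (@card_le_rel _ _ _ _ R) => [x Ax|x x' y _ _].
  have [->|nxm] := pselect (x = m); first by exists (f 0%N) => //; constructor 1.
  have [[n xn]|nx] := pselect (exists n, x = f n).
    by exists (f n.+1) => //; constructor 2; exists n.
  exists x => //; constructor 3; split=> //; split=> // n xn.
  by apply: nx; exists n.
case=> [[-> ->]|[n nxm [-> ->]]|[nxm [-> nx]]];
  case=> [[-> E]|[n' nxm' [-> E]]|[nxm' [E nx']]] //.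
- by move/fI: E.
- by case: (nx' 0%N).
- by move/fI: E.
- by move/fI: E => [->].
- by case: (nx' n.+1).
- by case: (nx 0%N).
- by case: (nx n'.+1).
Qed.

(** * Polar spaces *)

Section PolarSpace.
Variable G : pointLineGeometry.
Hypothesis polarG : is_polar_space G.
Implicit Types (p q r u v w x y z : points G) (l m D U : set (points G)).

Notation "p _|_ q" := (collinear p q) (at level 70).

Lemma collinear_sym p q : p _|_ q -> q _|_ p.
Proof. by case=> [->|[l [ll lp lq]]]; [left | right; exists l]. Qed.

Lemma line_collinear l p q : lines l -> l p -> l q -> p _|_ q.
Proof. by move=> ll lp lq; right; exists l. Qed.

Lemma subspace_line D l p q : is_subspace D -> lines l ->
  l p -> l q -> p <> q -> D p -> D q -> l `<=` D.
Proof. by move=> sD ll lp lq npq Dp Dq; apply: sD => //; exists p, q. Qed.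

Lemma collinear_point p l : lines l -> exists2 q, l q & p _|_ q.
Proof.
move=> ll; have [[q [[lq pq] _]]|all] := polarG p ll; first by exists q.
by have [q [_ [lq _ _]]] := lines_ge2 ll; exists q => //; apply: all.
Qed.

Lemma collinear_line p l q r x : lines l -> l q -> l r -> q <> r ->
  p _|_ q -> p _|_ r -> l x -> p _|_ x.
Proof.
move=> ll lq lr nqr pq pr; case: (polarG p ll) => [[s [_ su]] _|]; last exact.
by case: nqr; rewrite -(su q) // -(su r).
Qed.

Lemma perp_subspace p : is_subspace [set q | p _|_ q].
Proof.
move=> l ll [q [r [[lq pq] [lr pr] nqr]]] x lx.
exact: (collinear_line ll lq lr).
Qed.

Lemma subspaceI D1 D2 : is_subspace D1 -> is_subspace D2 -> is_subspace (D1 `&` D2).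
Proof.
move=> s1 s2 l ll [x [y [[lx [D1x D2x]] [ly [D1y D2y]] nxy]]] z lz; split.
  exact: (subspace_line s1 ll lx ly).
exact: (subspace_line s2 ll lx ly).
Qed.

Definition nondegenerate_on D :=
  is_subspace D /\ forall x, D x -> exists2 y, D y & ~ x _|_ y.

(** Suppose [x] and [y] are distinct, on a line [l]. Join a point [z] not collinear with [y] to a
    point [t] of [l] by a line [n], and a point [v] not collinear with [t] to a point [s] of [n] by
    a line [k]. The point [c] of [k] collinear with [x] is collinear with [y], hence with [t]. As
    [x] is not collinear with [s], [c] differs from [s], so [t] is collinear with all of [k],
    including [v]. *)
Lemma nondegenerate_on_perp_inj D x y : nondegenerate_on D -> D x -> D y ->
  (forall z, D z -> x _|_ z -> y _|_ z) -> x = y.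
Proof.
move=> [sD nD] Dx Dy xy; apply: contrapT => nxy.
have [//|[l [ll lx ly]]] : x _|_ y.
  by apply: collinear_sym; apply: xy => //; left.
have lD : l `<=` D by exact: (subspace_line sD ll lx ly).
have [z Dz nyz] := nD y Dy.
have nxz : ~ x _|_ z by move/(xy z Dz).
have [t lt zt] := collinear_point z ll.
have [E|[n [ln nz nt]]] := zt.
  by case: nyz; rewrite E; exact: line_collinear ll ly lt.
have Dt := lD t lt.
have zNt : z <> t by move=> E; apply: nyz; rewrite E; exact: line_collinear ll ly lt.
have nD' : n `<=` D by exact: (subspace_line sD ln nz nt).
have xt := line_collinear ll lx lt; have yt := line_collinear ll ly lt.
have [v Dv ntv] := nD t Dt.
have [s ns vs] := collinear_point v ln.
have Ds := nD' s ns.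
have sNt : s <> t by move=> E; apply: ntv; rewrite -E; exact: collinear_sym.
have nys : ~ y _|_ s.
  by move=> ys; apply: nyz; apply: (collinear_line ln ns nt).
have nxv : ~ x _|_ v.
  move=> xv; have yv := xy v Dv xv; apply: ntv; apply: collinear_sym.
  by apply: (collinear_line ll lx ly) => //; exact: collinear_sym.
have nxs : ~ x _|_ s by move/(xy s Ds).
have [E|[k [lk kv ks]]] := vs.
  by apply: ntv; rewrite E; exact: line_collinear ln nt ns.
have [c kc xc] := collinear_point x lk.
have cNs : c <> s by move=> E; apply: nxs; rewrite -E.
have vNs : v <> s.
  by move=> E; apply: ntv; rewrite E; exact: line_collinear ln nt ns.
have Dc : D c by exact: (subspace_line sD lk kv ks).
have tc : t _|_ c.
  apply: collinear_sym; apply: (collinear_line ll lx ly) => //.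
    exact: collinear_sym.
  by apply: collinear_sym; exact: xy.
apply: ntv; apply: (collinear_line lk kc ks) => //.
exact: line_collinear ln nt ns.
Qed.

(** For non-collinear [p] and [w] this models the lines of [D] through [p]: each meets it in its
    only point collinear with [w]. *)
Definition residue D p w := D `&` [set q | p _|_ q] `&` [set q | w _|_ q].

(** Every line of [D] through [p] has a point in the residue. A point [d] collinear with the whole
    residue is therefore collinear with all that is collinear with [p], which forces [p = d]. *)
Lemma nondegenerate_on_residue D p w : nondegenerate_on D -> D p -> D w ->
  ~ p _|_ w -> nondegenerate_on (residue D p w).
Proof.
move=> ndD Dp Dw npw; have [sD _] := ndD; split.
  by apply: subspaceI; [apply: subspaceI => //|]; exact: perp_subspace.
move=> d [[Dd /= pd] wd]; apply: contrapT => nd.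
suff E : p = d by apply: npw; rewrite E; exact: collinear_sym.
apply: (nondegenerate_on_perp_inj ndD) => // q Dq [<-|[l [ll lp lq]]].
  exact: collinear_sym.
have [pq|npq] := pselect (p = q); first by subst q; exact: collinear_sym.
have [q' lq' wq'] := collinear_point w ll.
have Dq' : D q' by exact: (subspace_line sD ll lp lq).
have q'p : q' <> p by move=> E; apply: npw; rewrite -E; exact: collinear_sym.
have dq' : d _|_ q'.
  apply: contrapT => ndq'; apply: nd; exists q' => //; split=> //; split=> //.
  exact: line_collinear ll lp lq'.
exact: (collinear_line ll lq' lp q'p dq' (collinear_sym pd)).
Qed.

(** Choose [w] collinear with [z] but not with [p], and [r'] on [l] collinear with [w]. Both [r']
    and [z] lie in the residue of [p] and [w], where collinearity with [r'] implies collinearity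
    with all of [l], hence with [z]. So [r' = z]. *)
Lemma line_double_perp D l p r z : nondegenerate_on D -> D p -> D r -> D z ->
  lines l -> l p -> l r -> p <> r ->
  (forall v, D v -> v _|_ p -> v _|_ r -> v _|_ z) -> l z.
Proof.
move=> ndD Dp Dr Dz ll lp lr npr dperp; have [sD _] := ndD.
have [<- //|npz] := pselect (p = z).
have [w Dw [zw npw]] : exists2 w, D w & z _|_ w /\ ~ p _|_ w.
  apply: contrapT => nw; apply: npz; apply/esym.
  apply: (nondegenerate_on_perp_inj ndD) => // w Dw zw.
  by apply: contrapT => npw; apply: nw; exists w.
have [r' lr' wr'] := collinear_point w ll.
have Dr' : D r' by exact: (subspace_line sD ll lp lr).
have r'p : r' <> p by move=> E; apply: npw; rewrite -E; exact: collinear_sym.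
have ndR := nondegenerate_on_residue ndD Dp Dw npw.
suff <- : r' = z by [].
apply: (nondegenerate_on_perp_inj ndR).
- by split=> //; split=> //; exact: line_collinear ll lp lr'.
- split=> /=; last exact: collinear_sym.
  split=> //=; apply: dperp => //; first by left.
  exact: line_collinear ll lp lr.
- move=> v [[Dv pv] wv] r'v; apply: collinear_sym; apply: dperp => //.
    exact: collinear_sym.
  by apply: (collinear_line ll lp lr' (nesym r'p)) => //; exact: collinear_sym.
Qed.

Hypothesis ndG : nondegenerate G.

Lemma nondegenerate_on_setT : nondegenerate_on setT.
Proof.
split=> // x _; apply: contrapT => nx; apply: ndG; exists x => y.
by apply: contrapT => nxy; apply: nx; exists y.
Qed.

(** Whatever is collinear with [p] and [q] is collinear with all of [n], so the double perp of [p]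
    and [q] puts [n] inside [k]. *)
Lemma line_uniq l m p q : lines l -> lines m -> p <> q ->
  l p -> l q -> m p -> m q -> l = m.
Proof.
suff sub k n : lines k -> lines n -> p <> q -> k p -> k q -> n p -> n q -> n `<=` k.
  by move=> ll lm npq *; apply/seteqP; split; apply: sub.
move=> lk ln npq kp kq np nq z nz.
apply: (line_double_perp nondegenerate_on_setT _ _ _ lk kp kq npq) => // v _ vp vq.
exact: (collinear_line ln np nq).
Qed.

Lemma lineN_perp l x u v : lines l -> l u -> l v -> u <> v -> ~ l x ->
  exists w, [/\ w _|_ u, w _|_ v & ~ x _|_ w].
Proof.
move=> ll lu lv nuv nlx; apply: contrapT => nw; apply: nlx.
apply: (line_double_perp nondegenerate_on_setT _ _ _ ll lu lv nuv) => // w _ wu wv.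
apply: collinear_sym; apply: contrapT => nxw; apply: nw; by exists w.
Qed.

(** The disjunct [y = x] keeps the apex when [U] is empty. *)
Definition cone x U :=
  [set y | y = x \/
    exists2 u, U u & exists l, [/\ lines l, l x, l u & l y]].

(* The Veblen-Young argument: a line of the cone avoiding [x] is projected from
   [x] to a line of [U]; a point [w] collinear with that line but not with [x]
   cuts out the projection of each point. *)
Lemma cone_subspace x U : is_subspace U -> (forall u v, U u -> U v -> u _|_ v) ->
  ~ U x -> is_subspace (cone x U).
Proof.
move=> sU singU nUx L lL [a [b [[La Va] [Lb Vb] nab]]] c Lc.
have UNx u : U u -> u <> x by move=> Uu E; apply: nUx; rewrite -E.
have [Lx|nLx] := pselect (L x).
  have [a' [La' a'x Va']] : exists a', [/\ L a', a' <> x & cone x U a'].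
    have [ax|] := pselect (a = x); last by exists a.
    by exists b; split=> // bx; apply: nab; rewrite ax bx.
  case: Va' => // -[u Uu [l [ll lx lu la']]]; right; exists u => //.
  by exists l; split=> //; rewrite (line_uniq ll lL a'x).
case: Va => [ax|[u Uu [l [ll lx lu la]]]]; first by case: nLx; rewrite -ax.
case: Vb => [bx|[v Uv [m [lm mx mv mb]]]]; first by case: nLx; rewrite -bx.
have nuv : u <> v.
  move=> E; subst v; have E := line_uniq ll lm (UNx _ Uu) lu lx mv mx.
  by apply: nLx; rewrite -(line_uniq ll lL nab) // E.
have [//|[M [lM Mu Mv]]] := singU _ _ Uu Uv.
have MU : M `<=` U by exact: (subspace_line sU lM Mu Mv).
have nMx : ~ M x by move/MU.
have xc : x _|_ c.
  apply: (collinear_line lL La Lb nab) => //; first exact: line_collinear ll lx la.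
  exact: line_collinear lm mx mb.
case: xc => [<-|[k [lk kx kc]]]; first by left.
have nxc : x <> c by move=> E; apply: nLx; rewrite E.
right; have [w [wu wv nxw]] := lineN_perp lM Mu Mv nuv nMx.
have ndR := nondegenerate_on_residue nondegenerate_on_setT I I nxw.
have [z kz wz] := collinear_point w lk.
exists z; last by exists k.
(* In the residue of [x] and [w], a point [t] collinear with [u] and [v] is also collinear with [x],
   hence with [a], [b], [c] and finally [z]. *)
apply: MU; apply: (line_double_perp ndR _ _ _ lM Mu Mv nuv).
- by split=> //; split=> //; exact: line_collinear ll lx lu.
- by split=> //; split=> //; exact: line_collinear lm mx mv.
- by split=> //; split=> //; exact: line_collinear lk kx kz.
move=> t [[_ xt] wt] tu tv; have tx := collinear_sym xt.
apply: (collinear_line lk kx kc) => //.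
apply: (collinear_line lL La Lb nab) => //.
  by apply: (collinear_line ll lx lu (nesym (UNx _ Uu))).
by apply: (collinear_line lm mx mv (nesym (UNx _ Uv))).
Qed.

End PolarSpace.

(** * Span and independence *)

Section Span.
Variable G : pointLineGeometry.
Implicit Types (p q x y : points G) (A B I S X Y : set (points G)).

Definition span X := smallest (@is_subspace G) X.

Definition independent X := forall x, X x -> ~ span (X `\ x) x.

Lemma span_subspace X : is_subspace (span X).
Proof.
move=> l ll [x [y [[lx sx] [ly sy] nxy]]] z lz M [sM XM].
have Mx : M x by apply: sx.
have My : M y by apply: sy.
exact: (subspace_line sM ll lx ly nxy Mx My).
Qed.

Lemma sub_span X : X `<=` span X. Proof. exact: sub_gen_smallest. Qed.

Lemma span_sub X Y : X `<=` span Y -> span X `<=` span Y.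
Proof. by move=> XY; apply: smallest_sub => //; exact: span_subspace. Qed.

Lemma spanS X Y : X `<=` Y -> span X `<=` span Y.
Proof. by move=> XY; apply: span_sub => x /XY; apply: sub_span. Qed.

(** Closure under lines is tested on two points, and two points of the union of the spans already
    lie in one of them. *)
Lemma span_bigcup T (J : set T) (F : T -> set (points G)) :
    (forall i j, J i -> J j -> F i `<=` F j \/ F j `<=` F i) ->
  span (\bigcup_(i in J) F i) `<=` \bigcup_(i in J) span (F i).
Proof.
move=> tot; apply: smallest_sub; last first.
  by move=> x [i Ji Fix]; exists i => //; apply: sub_span.
move=> l ll [x [y [[lx [i Ji xi]] [ly [j Jj yj]] nxy]]] z lz.
have [ij|ji] := tot i j Ji Jj.
  exists j => //; apply: (subspace_line (@span_subspace _) ll lx ly) => //.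
  exact: spanS xi.
exists i => //; apply: (subspace_line (@span_subspace _) ll lx ly) => //.
exact: spanS yj.
Qed.

Lemma independentS X Y : X `<=` Y -> independent Y -> independent X.
Proof.
move=> XY iY x Xx xs; apply: (iY x (XY x Xx)).
by apply: spanS xs; apply: setSD.
Qed.

Lemma independent_bigcup T (J : set T) (F : T -> set (points G)) :
    (forall i j, J i -> J j -> F i `<=` F j \/ F j `<=` F i) ->
    (forall i, J i -> independent (F i)) -> independent (\bigcup_(i in J) F i).
Proof.
move=> tot ind x [i Ji Fix]; rewrite setDE setI_bigcupl => /span_bigcup [].
  move=> j k Jj Jk; have [jk|kj] := tot j k Jj Jk; [left | right]; exact: setSI.
move=> j Jj; rewrite -setDE => sx; have [ij|ji] := tot i j Ji Jj.
  by apply: (ind j Jj x) => //; apply: ij.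
by apply: (ind i Ji x) => //; apply: spanS sx; apply: setSD.
Qed.

Lemma subspace_sub S X : is_subspace S -> X `<=` S -> span X `<=` S.
Proof. exact: smallest_sub. Qed.

Lemma singular_span S X : is_singular S -> X `<=` S -> is_singular (span X).
Proof.
move=> [sS cS] XS; split; first exact: span_subspace.
by move=> p q /(subspace_sub sS XS) Sp /(subspace_sub sS XS) Sq; apply: cS.
Qed.

Lemma is_singular_bigcup (C : set (set (points G))) :
  is_singular_chain C -> is_singular (\bigcup_(S in C) S).
Proof.
move=> [_ Csing tot]; split.
  move=> l ll [x [y [[lx [A CA Ax]] [ly [B CB By]] nxy]]] z lz.
  have [sA _] := Csing _ CA; have [sB _] := Csing _ CB.
  have [AB|BA] := tot A B CA CB.
    by exists B => //; apply: (subspace_line sB ll lx ly) => //; apply: AB.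
  by exists A => //; apply: (subspace_line sA ll lx ly) => //; apply: BA.
move=> p q [A CA Ap] [B CB Bq].
have [AB|BA] := tot A B CA CB.
  by apply: (Csing _ CB).2 => //; apply: AB.
by apply: (Csing _ CA).2 => //; apply: BA.
Qed.

Hypothesis polarG : is_polar_space G.
Hypothesis ndG : nondegenerate G.

(** The span of [x] and [A] lies in the cone from [x] over [span A], so [y] is [x] or lies on a line
    joining [x] to some [u] in [span A]. As [y] differs from [u], that line is spanned by [u] and
    [y]. *)
Lemma span_exchange S A x y : is_singular S -> A `<=` S -> S x ->
  span (x |` A) y -> ~ span A y -> span (y |` A) x.
Proof.
move=> singS AS Sx xAy nAy.
have [sA cA] := singular_span singS AS.
have nAx : ~ span A x.
  move=> Ax; apply: nAy; apply: span_sub xAy => z [->|] //; exact: sub_span.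
have cone_y : cone x (span A) y.
  apply: (subspace_sub (cone_subspace polarG ndG sA cA nAx)) xAy => z [->|Az].
    by left.
  have sAz := sub_span Az; right; exists z => //.
  have [xz|[l [ll lx lz]]] := singS.2 x z Sx (AS z Az); first by rewrite xz in nAx.
  by exists l.
case: cone_y => [->|[u Au [l [ll lx lu ly]]]]; first by apply: sub_span; left.
apply: (subspace_line (@span_subspace _) ll lu ly) => //.
- by move=> E; apply: nAy; rewrite -E.
- by apply: spanS Au => z Az; right.
- by apply: sub_span; left.
Qed.

Lemma independentU1 S X x : is_singular S -> X `<=` S -> S x ->
  independent X -> ~ span X x -> independent (x |` X).
Proof.
move=> singS XS Sx iX nXx y xXy; have [->|nyx] := pselect (y = x).
  by move=> sx; apply: nXx; apply: spanS sx => z [[->|//] /(_ erefl)].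
case: xXy => [//|Xy] sy.
have XDS : X `\ y `<=` S by move=> z [/XS].
apply: nXx; have : span (y |` (X `\ y)) x.
  apply: (span_exchange singS XDS Sx) (iX y Xy).
  by apply: spanS sy => z [[->|Xz] zy]; [left | right].
by apply: spanS => z [->|[]].
Qed.

Lemma basis_exists S : is_singular S ->
  exists B, [/\ B `<=` S, independent B & span B = S].
Proof.
move=> singS.
have [|B [[BS iB] Bmax]] := @Zorn_bigcup _ [set B | B `<=` S /\ independent B].
  move=> F FP tot; split; first by move=> x [B /FP[BS _]] /BS.
  by apply: independent_bigcup => [A B|A /FP[]]; first exact: tot.
exists B; split=> //; apply/seteqP; split; first exact: subspace_sub singS.1 BS.
move=> x Sx; apply: contrapT => nBx; apply: (Bmax (x |` B)).
  split=> [z Bz|E]; first by right.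
  by apply: nBx; apply: sub_span; apply: E; left.
split; first by move=> z [->|/BS].
exact: independentU1 singS BS Sx iB nBx.
Qed.

(* Steinitz exchange without finiteness: [R] records which elements [i] of [I]
   have been replaced by which elements [x] of [X]. *)
Lemma independent_card_le S I X : is_singular S -> I `<=` S -> independent I ->
  X `<=` S -> span X = S -> I #<= X.
Proof.
move=> singS IS iI XS spX.
pose dom (R : set (points G * points G)) := [set i | exists x, R (i, x)].
pose ran (R : set (points G * points G)) := [set x | exists i, R (i, x)].
pose swap R := (I `\` dom R) `|` ran R.
(* As kept elements and replacements are disjoint, deleting a kept [i] loses no replacement; a point
   outside the remaining span is thus a new replacement and injectivity survives. *)
pose P (R : set (points G * points G)) := [/\ R `<=` I `*` X,
  forall i j x, R (i, x) -> R (j, x) -> i = j, (I `\` dom R) `&` ran R `<=` set0 &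
  independent (swap R)].
have [|R [[RIX Rinj Rdisj Rind] Rmax]] := @Zorn_bigcup _ P.
  move=> F FP tot; split.
  - by move=> ix [R /FP[RIX _ _ _] /RIX].
  - move=> i j x [R FR ix] [R' FR' jx].
    have [_ inj _ _] := FP R FR; have [_ inj' _ _] := FP R' FR'.
    by have [/(_ _ ix) ?|/(_ _ jx) ?] := tot R R' FR FR';
      [apply: (inj' i j x _ jx) | apply: (inj i j x ix)].
  - move=> x [[Ix ndx] [j [R FR jx]]]; have [_ _ disj _] := FP R FR.
    apply: (disj x); split; last by exists j.
    by split=> // -[y xy]; apply: ndx; exists y, R.
  - pose U := \bigcup_(R in F) R.
    (* Removing [dom U] at every stage makes [T] monotone, with [T R] inside [swap R]. The extra
       stage [set0] supplies the kept elements even when [F] is empty. *)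
    pose T R := (I `\` dom U) `|` ran R.
    suff iT : independent (\bigcup_(R in set0 |` F) T R).
      apply: independentS iT => x [Ix|[i [R FR ix]]].
        by exists set0; [left | left].
      by exists R; [right | right; exists i].
    apply: independent_bigcup.
      have ranS (R R' : set (points G * points G)) : R `<=` R' -> T R `<=` T R'.
        by move=> RR' x [|[i ix]]; [left | right; exists i; apply: RR'].
      move=> R R' [->|FR]; first by left; apply: ranS.
      case=> [->|FR']; first by right; apply: ranS.
      by have [RR'|RR'] := tot R R' FR FR'; [left | right]; apply: ranS.
    move=> R [->|FR].
      by apply: independentS iI => x [[]|[]].
    have [_ _ _ ind] := FP R FR; apply: independentS ind.
    move=> x [[Ix nx]|]; [left | by right].
    by split=> // -[y xy]; apply: nx; exists y, R.
have RanX x : ran R x -> X x by move=> [i /RIX[]].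
apply: (card_le_rel (R := fun i x => R (i, x))) => [i Ii|i j x _ _]; last exact: Rinj.
apply: contrapT => ndi.
have {}ndi : ~ dom R i.
  by move=> [x ix]; apply: ndi; exists x => //; apply: RanX; exists i.
(* Since [X] spans [i] but [J] does not, some [x] of [X] lies outside [span J] and can replace
   [i]. *)
pose J := swap R `\ i.
have JS : J `<=` S by move=> x [[[/IS]|/RanX/XS]].
have nJi : ~ span J i by apply: Rind; left.
have [x Xx nJx] : exists2 x, X x & ~ span J x.
  apply: contrapT => nx; apply: nJi.
  have: span X i by rewrite spX; apply: IS.
  apply: span_sub => x Xx; apply: contrapT => nJx; apply: nx; by exists x.
have nranx : ~ ran R x.
  move=> rx; have [xi|nxi] := pselect (x = i).
    by apply: (Rdisj i); split=> //; rewrite -xi.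
  by apply: nJx; apply: sub_span; split=> //; right.
apply: (Rmax ((i, x) |` R)).
  split=> [z Rz|E]; first by right.
  by apply: ndi; exists x; apply: E; left.
split.
- by move=> jy [->|/RIX].
- move=> j k y [jy|jy] [ky|ky].
  + by case: jy => -> _; case: ky => -> _.
  + by case: jy ky => _ -> ky; case: nranx; exists k.
  + by case: ky jy => _ -> jy; case: nranx; exists j.
  + exact: Rinj jy ky.
- move=> y [[Iy ndy] [j [[_ yx]|jy]]].
    subst y; apply: nJx; apply: sub_span; split.
      by left; split=> // -[y xy]; apply: ndy; exists y; right.
    by move=> E; apply: ndy; exists x; left; rewrite E.
  apply: (Rdisj y); split; last by exists j.
  by split=> // -[z yz]; apply: ndy; exists z; right.
- have iJ : independent J by apply: independentS Rind => z [].
  apply: independentS (independentU1 singS JS (XS x Xx) iJ nJx) => y [[Iy ndy]|].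
    right; split; first by left; split=> // -[z yz]; apply: ndy; exists z; right.
    by move=> E; apply: ndy; exists x; left; rewrite E.
  case=> j [[_ ->]|jy]; first by left.
  right; split; first by right; exists j.
  by move=> E; apply: (Rdisj y); rewrite E; split=> //; rewrite -E; exists j.
Qed.

End Span.

(** * Chains of singular subspaces *)

Section Chains.
Variable G : pointLineGeometry.
Implicit Types (C : set (set (points G))) (A B S I : set (points G)).

(** Treats finite and infinite chains alike, and leaves the choice of the deleted member free. *)
Lemma chain_length_card C A : C A -> [set: chain_length C] #= C `\ A.
Proof.
move=> CA; rewrite /chain_length; case: asboolP => [finC|infC].
  have [n Cn] : finite_set (C `\ A) by apply: sub_finite_set finC => B [].
  have CSn : C #= `I_n.+1 by apply/eq_cardSP; exists A.
  rewrite (card_fset_set CSn) card_eq_sym; apply: card_eq_trans Cn _.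
  exact: card_II.
apply: card_eq_trans (card_sig C) _; rewrite card_eq_le infinite_setD1_card //=.
exact: card_le_setD.
Qed.

Hypothesis polarG : is_polar_space G.
Hypothesis ndG : nondegenerate G.

Lemma basis_generating_rank S I : is_singular S -> I `<=` S -> independent I ->
  span I = S -> is_generating_rank S {x | I x}.
Proof.
move=> singS IS iI spI; split; first by exists I; split; [| exact: card_sig].
move=> X [XS spX]; rewrite (card_le_eql (card_sig I)).
exact: (independent_card_le polarG ndG singS).
Qed.

Lemma wo_singular_chain_independent C : is_wo_singular_chain C ->
  exists A I, [/\ C A, I `<=` \bigcup_(S in C) S, independent I & C `\ A #<= I].
Proof.
move=> [singC wo]; have [[A0 CA0] Csing tot] := singC.
(* The discarded member [m] is the maximum of [C], which has no successor, or an arbitrary member if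
   there is no maximum. *)
have [m Cm nmax] : exists2 m, C m & forall A, C A -> A <> m ->
    exists2 B, C B & ~ B `<=` A.
  have [[m Cm mmax]|nmax] := pselect (exists2 m, C m & forall B, C B -> B `<=` m).
    exists m => // A CA nAm; exists m => // mA; apply: nAm.
    by apply/seteqP; split=> //; exact: mmax.
  exists A0 => // A CA _; apply: contrapT => nB; apply: nmax; exists A => // B CB.
  by apply: contrapT => nBA; apply: nB; exists B.
have [p0 _] := points_nonempty G.
have step A : exists p, C A -> A <> m ->
    ~ A p /\ forall B, C B -> ~ B `<=` A -> B p.
  have [[CA nAm]|nA] := pselect (C A /\ A <> m); last first.
    by exists p0 => CA nAm; case: nA.
  (* [N] is the successor of [A]: any member not inside [A] contains [N], hence the point chosen in
     [N] outside [A]. *)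
  have [||N [[CN nNA] Nmin]] := wo [set B | C B /\ ~ B `<=` A].
  - by move=> B [].
  - by have [B CB nBA] := nmax A CA nAm; exists B.
  have /existsNP[p /not_implyP[Np nAp]] := nNA.
  by exists p => _ _; split=> // B CB nBA; apply: (Nmin B).
have [pt ptP] := choice step.
pose I := pt @` (C `\ m).
have Cdec A B : C A -> C B -> A `<=` B \/ (B `<=` A /\ ~ A `<=` B).
  move=> CA CB; have [AB|nAB] := pselect (A `<=` B); first by left.
  by right; split=> //; case: (tot A B CA CB).
have IC : I `<=` \bigcup_(S in C) S.
  move=> _ [A [CA nAm] <-]; have [B CB nBA] := nmax A CA nAm.
  by exists B => //; apply: (ptP A CA nAm).2.
exists m, I; split=> //; last first.
  apply: (@card_le_rel _ _ _ _ (fun A p => pt A = p)) => [A CA|].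
    by exists (pt A) => //; exists A.
  move=> A A' p [CA nAm] [CA' nAm'] <- E; apply/seteqP; split; apply: contrapT => n.
    by apply: (ptP A CA nAm).1; rewrite -E; apply: (ptP A' CA' nAm').2.
  by apply: (ptP A' CA' nAm').1; rewrite E; apply: (ptP A CA nAm).2.
(* If [p = pt A] depends on the other points, let [B] be the least member of [C]
   whose points already span it; by continuity of span along chains the largest
   one, [q = pt A'], is needed, and exchanging [p] with [q] is impossible. *)
move=> _ [A [CA nAm] <-] sp; set p := pt A in sp *.
have [nAp pA] := ptP A CA nAm.
pose Q B := (I `\ p) `&` B.
have QS B B' : B `<=` B' -> Q B `<=` Q B' by move=> BB'; apply: setIS.
have [||B [[CB sQB] Bmin]] := wo [set B | C B /\ span (Q B) p].
- by move=> B [].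
- have : span (\bigcup_(B in C) Q B) p.
    apply: spanS sp => q Iq; have [B CB Bq] := IC q Iq.1.
    by exists B.
  case/span_bigcup => [B B' CB CB'|B CB sB]; last by exists B.
  by case: (tot B B' CB CB') => BB'; [left | right]; apply: QS.
have nQ A' : C A' -> ~ B `<=` A' -> ~ span (Q A') p.
  by move=> CA' nBA' sA'; apply: nBA'; apply: (Bmin A').
pose F A' := (I `\ p) `&` (pt A' |` A').
have : span (\bigcup_(A' in [set A' | [/\ C A', A' <> m & ~ B `<=` A']]) F A') p.
  apply: spanS sQB => q [[[A' [CA' nAm'] <-] qp] Bq]; exists A' => /=.
    by split=> // /(_ _ Bq); exact: (ptP A' CA' nAm').1.
  by split; [split=> //; exists A' | left].
case/span_bigcup => [A1 A2 [C1 n1 _] [C2 n2 _]|A' [CA' nAm' nBA'] spF].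
  suff FS X Y : C X -> X <> m -> C Y -> X `<=` Y -> ~ Y `<=` X -> F X `<=` F Y.
    have [A12|[A21 nA12]] := Cdec A1 A2 C1 C2; last by right; apply: FS.
    have [A21|[_ nA21]] := Cdec A2 A1 C2 C1; last by left; apply: FS.
    have -> : A1 = A2 by apply/seteqP.
    by left.
  move=> CX nX CY XY nYX x [Ix Xx]; split=> //; right.
  by case: Xx => [->|/XY //]; exact: (ptP X CX nX).2.
have [nqA' qA'] := ptP A' CA' nAm'; set q := pt A' in nqA' qA' spF *.
have [qp|nqp] := pselect (q = p).
  apply: (nQ A' CA' nBA'); apply: spanS spF => x [[Ix xp] [xq|A'x]].
    by case: xp; rewrite xq.
  by [].
have singU := is_singular_bigcup singC.
have QU : Q A' `<=` \bigcup_(S in C) S by move=> x [[/IC]].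
have Uq : (\bigcup_(S in C) S) q by apply: IC; exists A'.
have spq : span (p |` Q A') q.
  apply: (span_exchange polarG ndG singU QU Uq) (nQ A' CA' nBA').
  by apply: spanS spF => x [Ix [->|A'x]]; [left | right].
have sub_chain X Y : C Y -> X `<=` Y -> span X `<=` Y.
  by move=> CY; apply: subspace_sub; apply: (Csing _ CY).1.
(* If [p] lies in [A'], so does [q] by [spq]. Otherwise [A'] is properly below [A], so [A] contains
   [q] and, by [spF], also [p]. *)
have [A'p|nA'p] := pselect (A' p).
  apply: nqA'; apply: (sub_chain _ _ CA' _ _ spq) => x [->|[]] //.
have A'A : A' `<=` A by apply: contrapT => n; apply: nA'p; apply: pA.
have Aq : A q.
  by apply: qA' => // AA'; apply: nqp; congr pt; apply/seteqP.
by apply: nAp; apply: (sub_chain _ _ CA _ _ spF) => x [_ [->|/A'A]].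
Qed.

Lemma basis_wo_singular_chain S I : is_singular S -> I `<=` S -> independent I ->
  exists C, [/\ is_wo_singular_chain C, C S & I #<= C `\ S].
Proof.
move=> singS IS iI; have [lt [wf trans tot]] := well_order_exists (points G).
have irr x : ~ lt x x.
  have [|_ -> /(_ x erefl) //] := @wf_minimum _ lt [set x] wf.
  by exists x.
(* The initial segments are strict, so independence keeps [c] out of [V c]. This separates [V c]
   from every later [V d] and from [S], the added top that is discarded in the count. *)
pose V c := span (I `&` [set b | lt b c]).
have VS c : V c `<=` S by apply: subspace_sub singS.1 _ => x [/IS].
have nV c : I c -> ~ V c c.
  move=> Ic sc; apply: (iI c Ic); apply: spanS sc => x [Ix xc]; split=> // E.
  by apply: (irr c); rewrite -{1}E.
have Vlt c d : lt c d -> V c `<=` V d.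
  by move=> cd; apply: spanS => x [Ix xc]; split=> //; apply: trans xc cd.
pose C := [set A | A = S \/ exists2 c, I c & A = V c].
exists C; split; [split; first split | by left | ].
- by exists S; left.
- move=> A [->|[c Ic ->]] //; apply: (singular_span singS) => x [/IS] //.
- move=> A B [->|[c Ic ->]] [->|[d Id ->]]; [by left|by right|by left|].
  by case: (tot c d) => [cd|->|dc]; [left; apply: Vlt | left | right; apply: Vlt].
- move=> D DC [A DA].
  have [[c [Ic Dc]]|nc] := pselect (exists c, I c /\ D (V c)).
    have [|d [Id Dd] dmin] := @wf_minimum _ lt [set c | I c /\ D (V c)] wf.
      by exists c.
    exists (V d); split=> // B DB; have [E|[b Ib E]] := DC B DB; first by rewrite E.
    rewrite E; case: (tot d b) => [|->//|bd]; first exact: Vlt.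
    by case: (dmin b) => //; split; rewrite // -E.
  have DS B : D B -> B = S.
    by move=> DB; have [//|[b Ib E]] := DC B DB; case: nc; exists b; rewrite -E.
  by exists A; split=> // B /DS ->; rewrite (DS A DA).
- apply: (@card_le_rel _ _ _ _ (fun c A => A = V c)) => [c Ic|c d A Ic Id -> E].
    exists (V c) => //; split; first by right; exists c.
    by move=> E; apply: (nV c Ic); rewrite E; apply: IS.
  case: (tot c d) => // [cd|dc].
    by case: (nV c Ic); rewrite E; apply: sub_span.
  by case: (nV d Id); rewrite -E; apply: sub_span.
Qed.

End Chains.

Theorem mainTheorem7 (G : pointLineGeometry)
    (polarG : is_polar_space G) (ndG : nondegenerate G) :
  exists K : Type, is_prk_WO G K /\ is_prk G K.
Proof.
have [|K [Kub Kmin]] := @card_sup_exists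
    (fun L => exists S : set (points G), is_singular S /\ is_generating_rank S L)
    (points G).
  move=> L [S [_ [[X [_ LX]] _]]].
  by rewrite (card_le_eql LX); exact: card_leT.
(* [K] is the polar rank by construction. It remains to bound chain lengths by ranks, using the
   union of the chain, and ranks by chain lengths. *)
exists K; split=> //; split=> [_ [C [woC ->]]|M Mub].
  have [A [I [CA IU iI CI]]] := wo_singular_chain_independent polarG ndG woC.
  have singU := is_singular_bigcup woC.1.
  have [B [BU iB spB]] := basis_exists polarG ndG singU.
  rewrite (card_le_eql (chain_length_card CA)); apply: card_le_trans CI _.
  apply: card_le_trans (independent_card_le polarG ndG singU IU iI BU spB) _.
  rewrite -(card_le_eql (card_sig B)); apply: Kub.
  by exists (\bigcup_(S in C) S); split=> //; exact: basis_generating_rank.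
apply: Kmin => L [S [singS [_ Lmin]]].
have [B [BS iB spB]] := basis_exists polarG ndG singS.
have [C [woC CS BC]] := basis_wo_singular_chain singS BS iB.
apply: card_le_trans (Lmin B (conj BS spB)) _.
apply: card_le_trans BC _; rewrite -(card_le_eql (chain_length_card CS)).
by apply: Mub; exists C.
Qed.
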